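(* Let $d\ge 2$ be an integer and let $G$ be a group. (1) $G$ acts faithfully on the $d$-regular rooted tree $R_d$ with a global fixed point if and only if $G$ has an index $d$-chain. (2) $G$ acts faithfully with a global fixed point on the $(d+1)$-regular tree $T_{d+1}$ if and only if $G$ has an index $d$-chain, except that in this case the first index $[G_0:G_1]$ is allowed to be at most $d+1$ rather than at most $d$. That is, if and only if there is a descending sequence $G=G_0\ge G_1\ge G_2\ge\cdots$ of finite index subgroups with $\bigcap_{i\ge 0}G_i=\{\mathrm{id}\}$, $[G_0:G_1]\le d+1$ and $[G_i:G_{i+1}]\le d$ for all $i\ge 1$.
   Context: Trees are simplicial trees; actions on trees are by simplicial automorphisms, and a global fixed point is a point fixed by all group elements. $T_{d+1}$ is the tree in which every vertex has degree $d+1$. $R_d$ is the rooted tree whose root has degree $d$ and in which every other vertex has degree $d+1$ (so every automorphism fixes the root). For an integer $n\ge 2$, a group $G$ has an index $n$-chain if there is a descending sequence of finite index subgroups $G=G_0\ge G_1\ge G_2\ge\cdots$ with $\bigcap_{i=0}^{\infty}G_i=\{\mathrm{id}\}$ and such that $[G_i:G_{i+1}]\le n$ for all $i\ge 0$ (repetitions are allowed, so the chain may become constant). *)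

(* Defs.v *)
From HB Require Import structures.
From mathcomp Require Import all_boot all_order all_algebra.
From mathcomp Require Import boolp classical_sets functions cardinality reals.

Set Implicit Arguments.
Unset Strict Implicit.
Unset Printing Implicit Defensive.

Import Order.TTheory GRing.Theory Num.Theory.

Local Open Scope classical_set_scope.
Local Open Scope card_scope.

(** Chains consist of arbitrary (not necessarily decidable) subsets, so the
    library predicate [group_closed] is applied to [mem H] for [H : set G]. *)
Definition is_subgroup (G : groupType) (H : set G) : Prop :=
  group_closed (mem H).

Definition left_coset (G : groupType) (x : G) (K : set G) : set G :=
  [set (x * k)%g | k in K].

Definition left_cosets (G : groupType) (H K : set G) : set (set G) :=
  [set left_coset x K | x in H].

Definition finite_index (G : groupType) (K : set G) : Prop :=
  finite_set (left_cosets [set: G] K).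

(** [[H : K] <= n]; in particular the index is finite. *)
Definition index_le (G : groupType) (H K : set G) (n : nat) : Prop :=
  left_cosets H K #<= `I_n.

Definition descending_chain (G : groupType) (C : nat -> set G) : Prop :=
  [/\ C 0%N = [set: G],
      forall i, is_subgroup (C i) /\ finite_index (C i),
      forall i, C i.+1 `<=` C i
    & \bigcap_i C i = [set 1%g]].

Definition has_index_chain (n : nat) (G : groupType) : Prop :=
  exists C : nat -> set G,
    descending_chain C /\ forall i, index_le (C i) (C i.+1) n.

(** A graph is a set of vertices [V] with a symmetric irreflexive adjacency
    relation [e]; [ucycle e c] says that [c] is a closed walk with pairwise
    distinct vertices, so that [size c <= 2] excludes genuine circuits. *)
Definition is_tree (V : choiceType) (e : rel V) : Prop :=
  [/\ symmetric e, irreflexive e, inhabited V,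
      forall x y, exists2 p, path e x p & last x p = y
    & forall c, ucycle e c -> (size c <= 2)%N].

Definition has_degree (V : choiceType) (e : rel V) (v : V) (n : nat) : Prop :=
  [set w | e v w] #= `I_n.

Definition is_regular_tree (n : nat) (V : choiceType) (e : rel V) : Prop :=
  is_tree e /\ forall v, has_degree e v n.

Definition is_regular_rooted_tree (d : nat) (V : choiceType) (e : rel V)
    (r : V) : Prop :=
  [/\ is_tree e, has_degree e r d
    & forall v, v <> r -> has_degree e v d.+1].

(** A simplex is given by the list of its vertices. *)
Definition is_simplex (V : choiceType) (e : rel V) (s : seq V) : Prop :=
  (exists v, s = [:: v]) \/ (exists u v, e u v /\ s = [:: u; v]).

(** A point of the geometric realization, given by its barycentric coordinates,
    so midpoints of (possibly inverted) edges are points too. *)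
Definition is_point (R : realType) (V : choiceType) (e : rel V) (p : V -> R) :
    Prop :=
  (forall v, (0 <= p v)%R) /\
  exists s : seq V,
    [/\ is_simplex e s, forall v, v \notin s -> p v = 0%R
      & (\sum_(v <- s) p v = 1)%R].

(** A left action by graph automorphisms; bijectivity of each [a g] follows
    from the first two conditions. *)
Definition is_tree_action (G : groupType) (V : choiceType) (e : rel V)
    (a : G -> V -> V) : Prop :=
  [/\ forall v, a 1%g v = v,
      forall g h v, a (g * h)%g v = a g (a h v)
    & forall g, {mono a g : u v / e u v}].

Definition is_faithful (G : groupType) (V : choiceType) (a : G -> V -> V) :
    Prop :=
  forall g, (forall v, a g v = v) -> g = 1%g.

(** The affine extension of the action to the realization: [g . p] has
    coordinate [p (g^-1 v)] at [v]. *)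
Definition act_point (R : realType) (G : groupType) (V : choiceType)
    (a : G -> V -> V) (g : G) (p : V -> R) : V -> R :=
  fun v => p (a g^-1%g v).

Definition has_global_fixed_point (R : realType) (G : groupType)
    (V : choiceType) (e : rel V) (a : G -> V -> V) : Prop :=
  exists2 p : V -> R, is_point e p & forall g, act_point a g p = p.

Definition acts_faithfully_with_fixed_point (R : realType) (G : groupType)
    (V : choiceType) (e : rel V) : Prop :=
  exists a : G -> V -> V,
    [/\ is_tree_action e a, is_faithful a & has_global_fixed_point R e a].

Section ParentTree.
Variables (V : choiceType) (r : V) (par : V -> V) (h : V -> nat).
Hypothesis hpar : forall v, v != r -> h v = (h (par v)).+1.

Definition parent_rel : rel V :=
  fun x y => (x != r) && (par x == y) || (y != r) && (par y == x).

Lemma parent_rel_sym : symmetric parent_rel.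
Proof. by move=> x y; rewrite /parent_rel orbC. Qed.

Lemma parent_relP x y : parent_rel x y -> (h y <= h x)%N -> par x = y.
Proof.
case/orP => /andP[nr /eqP E] //; last by rewrite (hpar nr) E ltnn.
Qed.

Lemma parent_rel_irr : irreflexive parent_rel.
Proof.
move=> x; apply/negbTE; rewrite /parent_rel orbb.
by apply/negP => /andP[/hpar + /eqP E]; rewrite E => /n_Sn.
Qed.

Lemma parent_rel_root x : exists2 p, path parent_rel x p & last x p = r.
Proof.
have [n] := ubnP (h x); elim: n x => // n IH x.
have [->|nr] := eqVneq x r; first by exists [::].
rewrite (hpar nr) ltnS => /IH[p pp lp].
by exists (par x :: p) => //=; rewrite pp /parent_rel nr eqxx.
Qed.

Lemma parent_tree : is_tree parent_rel.
Proof.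
split; [exact: parent_rel_sym | exact: parent_rel_irr | exact: inhabits r | | ].
- move=> x y.
  have [p pp lp] := parent_rel_root x; have [q qq lq] := parent_rel_root y.
  exists (p ++ rev (belast y q)).
    rewrite cat_path pp lp -lq rev_path.
    by rewrite (eq_path (e' := parent_rel)) // => ? ?; exact: parent_rel_sym.
  rewrite last_cat lp; case: q qq lq => [|z q] /= _ lq; first by rewrite lq.
  by rewrite rev_cons last_rcons.
- move=> c uc; rewrite leqNgt; apply/negP => c3.
  have [x xc xmax] : exists2 x, x \in c & forall y, y \in c -> (h y <= h x)%N.
    case: c {uc} c3 => // x0 c _; elim: c x0 => [|z c IH] x0.
      by exists x0; rewrite ?mem_head // => y; rewrite inE => /eqP ->.
    have [x xc xm] := IH z; have [le|lt] := leqP (h x0) (h x).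
      exists x; first by rewrite inE xc orbT.
      by move=> y; rewrite inE => /predU1P[->|/xm].
    exists x0; first exact: mem_head.
    by move=> y; rewrite inE => /predU1P[->|/xm hy] //; exact: leq_trans hy (ltnW lt).
  have [i c' Ec] := rot_to xc.
  have mc : forall y, (y \in c) = (y \in x :: c') by move=> y; rewrite -Ec mem_rot.
  have : ucycle parent_rel (x :: c') by rewrite -Ec rot_ucycle.
  have : (2 < size (x :: c'))%N by rewrite -Ec size_rot.
  case: c' {Ec} mc => [|y [|z s]] // mc _ /andP[/=].
  rewrite rcons_path => /and3P[exy _ /andP[_ elx]] /and3P[_ yn _].
  have pxy : par x = y by apply: parent_relP exy _; rewrite xmax // mc !inE eqxx orbT.
  have lm : last z s \in z :: s by exact: mem_last.
  have pxl : par x = last z s.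
    apply: parent_relP; first by rewrite parent_rel_sym; exact: elx.
    by rewrite xmax // mc inE [X in _ || X]inE lm !orbT.
  by move: yn; rewrite -pxy pxl lm.
Qed.

End ParentTree.

Lemma has_degree_codom (V : choiceType) (e : rel V) (v : V) (T : finType)
    (f : T -> V) (n : nat) :
  injective f -> #|T| = n -> (forall w, e v w <-> exists t, f t = w) ->
  has_degree e v n.
Proof.
move=> finj cT ew; rewrite /has_degree.
have -> : [set w | e v w] = f @` [set: T].
  apply/seteqP; split => w /=; first by move/ew => [t <-]; exists t.
  by move=> [t _ <-]; apply/ew; exists t.
apply: (card_eq_trans (inj_card_eq _)); first by move=> ? ? _ _; apply: finj.
rewrite card_eq_sym -cT.
have -> : `I_#|T| = (fun t : T => enum_rank t : nat) @` [set: T].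
  apply/seteqP; split => k /=; last by move=> [t _ <-]; apply: ltn_ord.
  by move=> lk; exists (enum_val (Ordinal lk)); rewrite ?enum_valK.
by apply: inj_card_eq => ? ? _ _ /val_inj/enum_rank_inj.
Qed.

Lemma regular_rooted_tree_exists (d : nat) :
  exists (V : choiceType) (e : rel V) (r : V), is_regular_rooted_tree d e r.
Proof.
pose V : choiceType := seq 'I_d.
have hp (v : V) : v != [::] -> size v = (size (behead v)).+1 by case: v.
exists V, (parent_rel [::] behead), [::]; split.
- exact: parent_tree hp.
- apply: (@has_degree_codom _ _ _ 'I_d (fun i => [:: i])) => [i j []||w] //.
    exact: card_ord.
  rewrite /parent_rel eqxx /=; split=> [|[i <-]] //.
  by case: w => [|i w] //= /eqP ->; exists i.
- case=> [|i v] // _.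
  pose f (o : option 'I_d) : V := if o is Some j then [:: j, i & v] else v.
  apply: (@has_degree_codom _ _ _ _ f); last 1 first.
  + move=> w; rewrite /parent_rel /=; split.
      case/orP => [/eqP <-|]; first by exists None.
      by case: w => [|j w] //= /eqP ->; exists (Some j).
    by case=> [[j|]] <- /=; rewrite ?eqxx ?orbT.
  + by move=> [j|] [k|] //= => [[->]|/(congr1 size)|/(congr1 size)] //= /eqP;
      rewrite eqn_leq ?ltnn ?andbF // => /andP[]; rewrite ltnNge leqnSn.
  + by rewrite card_option card_ord.
Qed.

Lemma regular_tree_exists (d : nat) :
  exists (V : choiceType) (e : rel V), is_regular_tree d.+1 e.
Proof.
pose V : choiceType := option ('I_d.+1 * seq 'I_d)%type.
pose par (v : V) : V := if v is Some (i, _ :: s) then Some (i, s) else None.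
pose h (v : V) := if v is Some (_, s) then (size s).+1 else 0%N.
have hp v : v != None -> h v = (h (par v)).+1 by case: v => [[i [|j s]]|].
exists V, (parent_rel None par); split; first exact: parent_tree hp.
case=> [[i s]|].
- pose f (o : option 'I_d) : V :=
    if o is Some j then Some (i, j :: s) else par (Some (i, s)).
  apply: (@has_degree_codom _ _ _ _ f); last 1 first.
  + move=> w; rewrite /parent_rel /= -/(par (Some (i, s))); split.
      case/orP => [/eqP <-|]; first by exists None.
      by case: w => [[k [|j w]]|] //= /eqP [-> ->]; exists (Some j).
    by case=> [[j|]] <- /=; rewrite ?eqxx ?orbT.
  + have fN j : f (Some j) <> f None.
      move/(congr1 h); rewrite /f /=; case: (s) => //= _ t [].
      by elim: (size t) => // n IH [].
    by case=> [j|] [k|] //; [case=> -> | move/fN | move/esym/fN].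
  + by rewrite card_option card_ord.
- apply: (@has_degree_codom _ _ _ _ (fun i => Some (i, [::]))) => [i j []||w] //.
    exact: card_ord.
  rewrite /parent_rel /=; split=> [|[i <-]] //.
  by case: w => [[i [|j s]]|] //= _; exists i.
Qed.

(* Main.v *)
Require Import Defs.
From HB Require Import structures.
From mathcomp Require Import all_boot all_order all_algebra.
From mathcomp Require Import boolp classical_sets functions cardinality reals.

Set Implicit Arguments.
Unset Strict Implicit.
Unset Printing Implicit Defensive.

Local Open Scope classical_set_scope.
Local Open Scope card_scope.

(** From an action to a chain: start from the root (or from an end of the edge
    carrying the fixed point, together with a neighbour) and intersect with the
    stabilizers of further vertices one at a time, each adjacent to a vertex
    that is already fixed. The orbit of the new vertex avoids the parent, so
    the index is at most [d].

    From a chain to an action: label the vertices of the tree by words, and let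
    some of the letters at depth [i] name the cosets of [C (i+1)] in [C i], so
    that words in these letters name the cosets of the [C i] in [G], on which
    [G] acts by translation. Letters after the first one that names no coset
    are left unchanged. An element acting trivially fixes every coset [C i],
    hence lies in the intersection of the chain. *)

(** * Subgroups, cosets and indices *)

Section Subgroups.
Local Open Scope group_scope.
Variable G : groupType.
Implicit Types (H K : set G) (g h x y : G).

Lemma is_subgroupP H :
  is_subgroup H <-> H 1 /\ forall x y, H x -> H y -> H (x * y^-1).
Proof.
split=> [[H1 HV]|[H1 HV]]; split.
- by move: H1; rewrite inE.
- by move=> x y Hx Hy; have := HV x y; rewrite !inE; apply.
- by rewrite inE.
- by move=> x y; rewrite !inE; apply: HV.
Qed.

Lemma subgroup1 H : is_subgroup H -> H 1.
Proof. by case/is_subgroupP. Qed.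

Lemma subgroupV H x : is_subgroup H -> H x -> H x^-1.
Proof. by case/is_subgroupP => H1 HV Hx; rewrite -[x^-1]mul1g; apply: HV. Qed.

Lemma subgroupM H x y : is_subgroup H -> H x -> H y -> H (x * y).
Proof.
move=> sH Hx Hy; rewrite -[y]invgK; case/is_subgroupP: (sH) => _; apply=> //.
exact: subgroupV.
Qed.

Lemma left_cosetP K x y : left_coset x K y <-> K (x^-1 * y).
Proof.
split=> [[k Kk <-]|Kxy]; first by rewrite mulKg.
by exists (x^-1 * y) => //; rewrite mulVKg.
Qed.

Lemma left_coset_eqP K x y : is_subgroup K ->
  left_coset x K = left_coset y K <-> K (x^-1 * y).
Proof.
move=> sK; split=> [E|Kxy].
  by apply/left_cosetP; rewrite E; apply/left_cosetP; rewrite mulVg; exact: subgroup1.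
apply/seteqP; split=> z /left_cosetP Kz; apply/left_cosetP.
  rewrite -[z](mulVKg x) mulgA; apply: subgroupM => //.
  by rewrite -[y^-1 * x]invgK invgM invgK; apply: subgroupV.
by rewrite -[z](mulVKg y) mulgA; apply: subgroupM.
Qed.

Lemma index_le_fibers (T : Type) (f : G -> T) (A : set T) H K n :
  K `<=` H -> is_subgroup H ->
  (forall x y, H x -> H y -> f x = f y <-> K (x^-1 * y)) ->
  (forall x, H x -> A (f x)) -> A #<= `I_n -> index_le H K n.
Proof.
move=> KH sH fK fA An; apply: card_le_trans An.
have fAH : f @` H `<=` A by move=> _ [x Hx <-]; apply: fA.
apply: card_le_trans (subset_card_le fAH).
suff -> : left_cosets H K =
    (fun t => [set x | H x /\ f x = t]) @` (f @` H) by exact: card_image_le.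
have E x : H x -> left_coset x K = [set z | H z /\ f z = f x].
  move=> Hx; apply/seteqP; split=> z /=.
    move/left_cosetP => Kz; have Hz : H z.
      by rewrite -[z](mulVKg x); apply: subgroupM => //; apply: KH.
    by split=> //; symmetry; apply/fK.
  by move=> [Hz fz]; apply/left_cosetP/fK.
apply/seteqP; split=> [_ [x Hx <-]|_ [_ [x Hx <-] <-]].
  by exists (f x); [exists x | rewrite E].
by exists x => //; rewrite E.
Qed.

Lemma index_le_sub H K m n : (m <= n)%N -> index_le H K m -> index_le H K n.
Proof. by move=> mn HK; apply: (card_le_trans HK); rewrite card_le_II. Qed.

Lemma finite_index_setT : finite_index [set: G].
Proof.
apply: (@sub_finite_set _ _ [set [set: G]]); last exact: finite_set1.
move=> _ [x _ <-]; apply/seteqP; split=> y // _.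
exact/left_cosetP.
Qed.

(** With [r] a chosen representative of [x H], the coset [x K] is recovered from the pair formed by
    [x H] and the coset of [r^-1 * x] in [H/K]; only finitely many such pairs exist. *)
Lemma finite_index_trans H K n :
  finite_index H -> is_subgroup H -> index_le H K n -> finite_index K.
Proof.
move=> fH sH HK; have fK : finite_set (left_cosets H K).
  by apply/finite_set_leP; exists n.
have [r rP] : exists r : set G -> G, forall x, H ((r (left_coset x H))^-1 * x).
  have /choice[r rP] : forall S : set G, exists y, S !=set0 -> S y.
    by move=> S; have [[y Sy]|nS] := pselect (S !=set0); [exists y | exists 1].
  exists r => x; have /rP/left_cosetP Hr : left_coset x H !=set0.
    by exists x; apply/left_cosetP; rewrite mulVg; exact: subgroup1.
  by rewrite -[x in _ * x]invgK -invgM; apply: subgroupV.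
apply: (@sub_finite_set _ _ ((fun p => [set r p.1 * y | y in p.2]) @`
    (left_cosets setT H `*` left_cosets H K))).
  move=> _ [x _ <-]; exists (left_coset x H, left_coset ((r (left_coset x H))^-1 * x) K).
    by split; [exists x | exists ((r (left_coset x H))^-1 * x)].
  apply/seteqP; split=> [_ [y /left_cosetP Ky <-]|y /left_cosetP Ky].
    by apply/left_cosetP; move: Ky; rewrite invgM invgK -!mulgA.
  exists ((r (left_coset x H))^-1 * y); last by rewrite mulVKg.
  by apply/left_cosetP; rewrite invgM invgK -!mulgA mulVKg.
apply: finite_image; exact: finite_setX.
Qed.

(** The action of [H] on [H/K], with cosets named by letters [j < n] and the
    unused letters fixed, together with a cocycle [k] into [K] describing the
    action on what lies below each letter; the letter [z] names [K] itself. *)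
Lemma coset_cocycle H K n :
  is_subgroup H -> is_subgroup K -> K `<=` H -> index_le H K n ->
  exists (s : G -> nat -> nat) (k : G -> nat -> G) (z : nat),
    [/\ forall h j, H h -> K (k h j) /\ ((j < n)%N -> (s h j < n)%N),
        forall j, s 1 j = j /\ k 1 j = 1,
        forall g h j, H g -> H h ->
          s (g * h) j = s g (s h j) /\ k (g * h) j = k g (s h j) * k h j
      & (z < n)%N /\ forall h, H h -> s h z = z -> K h /\ k h z = h].
Proof.
move=> sH sK KH HK.
have /pcard_leP/unsquash i := HK.
pose c h := i (left_coset h K).
have c_lt h : H h -> (c h < n)%N by move=> Hh; apply: (@funS _ _ _ _ i); exists h.
have cP g h : H g -> H h -> c g = c h <-> K (g^-1 * h).
  move=> Hg Hh; split=> [|/left_coset_eqP E]; last by rewrite /c E.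
  move/(@inj _ _ _ i) => E; apply/left_coset_eqP => //; apply: E; rewrite inE.
    by exists g.
  by exists h.
have H1 := subgroup1 sH.
pose used j := exists2 h, H h & c h = j.
(* Coset representatives, normalized to be 1 on the trivial coset. This makes [k h (c 1)] equal to
   [h] whenever [h] fixes the letter [c 1]. *)
have /choice[t tP] : forall j, exists t,
    (used j -> H t /\ c t = j) /\ (j = c 1 -> t = 1).
  move=> j; have [->|j1] := pselect (j = c 1); first by exists 1.
  by have [[h Hh ch]|nu] := pselect (used j); [exists h | exists 1].
have tU j : used j -> H (t j) by case: (tP j) => + _ u => /(_ u)[].
have tc j : used j -> c (t j) = j by case: (tP j) => + _ u => /(_ u)[].
have tK h : H h -> K ((t (c h))^-1 * h).
  move=> Hh; have u : used (c h) by exists h.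
  by apply/cP => //; [exact: tU | rewrite tc].
pose s h j := if `[< used j >] then c (h * t j) else j.
(* The Schreier element: what remains of [h] in [K] after it carries the representative of [j] to
   that of [s h j]. *)
pose k h j := if `[< used j >] then (t (c (h * t j)))^-1 * (h * t j) else 1.
have uS h j : H h -> used j -> used (c (h * t j)).
  by move=> Hh u; exists (h * t j) => //; apply: subgroupM => //; exact: tU.
exists s, k, (c 1); split.
- move=> h j Hh; rewrite /s /k; case: asboolP => [u|_]; last first.
    by split=> //; exact: subgroup1.
  have Hht : H (h * t j) by apply: subgroupM => //; exact: tU.
  by split=> [|_]; [exact: tK | exact: c_lt].
- move=> j; rewrite /s /k; case: asboolP => // u.
  by rewrite !mul1g tc // mulVg.
- move=> g h j Hg Hh; rewrite /s /k; case: (asboolP (used j)) => [u|nu]; last first.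
    by rewrite asboolF // mulg1.
  have u' := uS _ _ Hh u; rewrite asboolT //.
  have E : c (g * h * t j) = c (g * t (c (h * t j))).
    apply/esym/cP.
    - by apply: subgroupM => //; exact: tU.
    - by apply: subgroupM; [|exact: subgroupM|exact: tU].
    - rewrite invgM -!mulgA mulKg; apply: tK.
      by apply: subgroupM => //; exact: tU.
  by split=> //; rewrite E -!mulgA mulVKg.
- have u1 : used (c 1) by exists 1.
  have t1 : t (c 1) = 1 by case: (tP (c 1)) => _; apply.
  split; first exact: c_lt.
  move=> h Hh; rewrite /s /k !asboolT // t1 mulg1 => ch.
  rewrite ch t1 invg1 mul1g; split=> //.
  by have /cP := esym ch; rewrite invg1 mul1g; apply.
Qed.

End Subgroups.

(** The number of children at depth [k]. Taking [m = d] gives the rooted tree and [m = d.+1] the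
    regular one, so both are treated at once. *)
Definition branching (m d k : nat) : nat := if k is 0 then m else d.

(** Words list the choices made along a descending path, last choice first. *)
Fixpoint word (m d : nat) (s : seq nat) : bool :=
  if s is j :: s' then (j < branching m d (size s'))%N && word m d s' else true.

Definition enumerates (V : Type) (f : nat -> V) (n : nat) (A : set V) : Prop :=
  (forall i j, (i < n)%N -> (j < n)%N -> f i = f j -> i = j) /\
  forall w, A w <-> exists2 i, (i < n)%N & f i = w.

(** * Enumerating neighbours and naming the vertices of a tree by words *)

Section Degrees.
Variables (V : choiceType) (e : rel V).

Lemma has_degree_inj v m n : has_degree e v m -> has_degree e v n -> m = n.
Proof. by rewrite /has_degree card_eq_sym => /card_eq_trans h /h /card_eq_II. Qed.

Lemma has_degree_enum v n : has_degree e v n ->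
  exists f, enumerates f n [set w | e v w].
Proof.
move=> /card_set_bijP [g [gA gI gS]].
have /choice[f fP] : forall j, exists w, (j < n)%N -> e v w /\ g w = j.
  move=> j; have [jn|_] := boolP (j < n)%N; last by exists v.
  by have [w vw <-] := gS j jn; exists w.
exists f; split=> [i j /fP[_ fi] /fP[_ fj] fij|w].
  by rewrite -fi -fj fij.
split=> [vw|[i /fP[vw _] <-] //].
have gw : (g w < n)%N by exact: gA.
have [vf gf] := fP _ gw.
by exists (g w) => //; apply: gI; rewrite ?inE.
Qed.

Lemma has_degree_enum_but v q n : has_degree e v n.+1 -> e v q ->
  exists f, enumerates f n [set w | e v w /\ w <> q].
Proof.
move=> /has_degree_enum[f [fI fS]] /fS[k kn fk].
(* [bump k] skips the index [k] of the excluded neighbour [q]. *)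
have bump_lt i : (i < n)%N -> (bump k i < n.+1)%N.
  by rewrite /bump; case: (k <= i)%N => /= hi; rewrite ?add0n ?add1n ?ltnS // ltnW.
exists (f \o bump k); split=> [i j /bump_lt hi /bump_lt hj /(fI _ _ hi hj)|w].
  exact: (can_inj (bumpK k)).
split=> [[/fS[i hi <-] fiq]|[i hi <-]]; last first.
  split; first by apply/fS; exists (bump k i) => //; exact: bump_lt.
  by rewrite -fk => /(fI _ _ (bump_lt _ hi) kn)/esym/eqP; rewrite (negPf (neq_bump _ _)).
have ki : i != k by apply/eqP => ik; apply: fiq; rewrite ik.
exists (unbump k i); last by rewrite /= unbumpKcond (negPf ki) add0n.
rewrite /unbump; case: (ltngtP k i) ki => // [ki|ik] _.
  by rewrite subn1; case: (i) ki hi.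
by rewrite subn0; exact: leq_trans ik kn.
Qed.

Lemma enumerates_card (f : nat -> V) n A : enumerates f n A -> A #<= `I_n.
Proof.
move=> [_ fS]; apply: card_le_trans (card_image_le f `I_n).
by apply: subset_card_le => w /fS[i hi <-]; exists i.
Qed.

End Degrees.

Section Coordinates.
Variables (V : choiceType) (e : rel V).
Hypothesis te : is_tree e.

Let e_sym : symmetric e. Proof. by case: te. Qed.
Let e_irr : irreflexive e. Proof. by case: te. Qed.

(* Otherwise the walk from [w] to [v] and on along [p] up to [w] is a circuit. *)
Lemma tree_path_extend v p w : path e v p -> uniq (v :: p) -> e v w ->
  w \in p -> ohead p = Some w.
Proof.
move=> vp up vw wp; case: te => _ _ _ _ /= acyc.
case/splitPr: p / wp vp up => -[//|y p1] p2 vp up.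
suff /acyc : ucycle e [:: w, v, y & p1] by [].
move: vp up; rewrite cat_path -cat_cons cat_uniq.
move=> /andP[vyp /= /andP[lw _]] /and3P[u1 /norP[wn _] _].
have -> : ucycle e [:: w, v, y & p1] =
    [&& e w v, path e v (rcons (y :: p1) w) & uniq [:: w, v, y & p1]].
  by rewrite /ucycle /= !andbA.
rewrite rcons_path vyp lw e_sym vw /=; exact/andP.
Qed.

Lemma tree_uniq_path v p q : path e v p -> uniq (v :: p) -> path e v q ->
  uniq (v :: q) -> last v p = last v q -> p = q.
Proof.
(* Two paths leave [y], one through [w] and one avoiding [w]: the second never ends on the first.
   Stepping along [p'] to [y2] lengthens the other path to [y2, y, w, a], which is again simple. *)
have aux p' : forall y w a, path e y p' -> uniq [:: w, y & p'] ->
    path e y (w :: a) -> uniq [:: y, w & a] -> last y p' \notin w :: a.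
  elim: p' => [|y2 p' IH] y w a yp up ya ua.
    by move: ua => /= /andP[].
  have y2n : y2 \notin w :: a.
    apply/negP => /(tree_path_extend ya ua); move: yp => /= /andP[yy2 _] /(_ yy2)[E].
    by move: up; rewrite /= E !inE eqxx !orbT.
  have : last y2 p' \notin [:: y, w & a].
    apply: IH; first by case/andP: yp.
    - by case/andP: up.
    - by rewrite /= e_sym; move: yp ya => /= /andP[-> _].
    - move: ua; rewrite /= => ->; rewrite andbT inE negb_or y2n andbT.
      by move: up => /= /and3P[_ + _]; rewrite inE negb_or eq_sym => /andP[].
  by rewrite inE negb_or => /andP[].
elim: p v q => [|y p IH] v [|z q] //.
- by move=> _ _ _ /= /andP[vn _] E; move: vn; rewrite E mem_last.
- by move=> _ /= /andP[vn _] _ _ E; move: vn; rewrite -E mem_last.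
move=> vp up vq uq E.
have [yz|yz] := eqVneq y z.
  move: vp vq up uq E; rewrite -yz => /= /andP[_ yp] /andP[_ yq] /andP[_ up] /andP[_ uq] E.
  by congr cons; apply: IH yp _ yq _ E.
have [vy yp] : e v y /\ path e y p by apply/andP.
have yn : y \notin z :: q.
  by apply/negP => /(tree_path_extend vq uq vy)[zy]; rewrite zy eqxx in yz.
have nyv : y != v by apply/eqP => yv; move: vy; rewrite yv e_irr.
(* The first steps [y] and [z] differ. Seen from [y], the path [p] avoids [v], while the path back
   through [v] continues along [z :: q]. *)
have : last y p \notin [:: v, z & q].
  by apply: aux => //; [rewrite /= e_sym vy | rewrite cons_uniq inE negb_or nyv yn].
move: E; rewrite /= => ->; by rewrite inE mem_last orbT.
Qed.

Variables (r : V) (m d : nat).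
Hypothesis deg_r : has_degree e r m.
Hypothesis deg : forall v, v <> r -> has_degree e v d.+1.

(* The recursion carries along a vertex [v] the path [p] from [v] to the root. *)
Lemma tree_coordinates : exists x : seq nat -> V,
  [/\ x [::] = r,
      forall s t, word m d s -> word m d t -> x s = x t -> s = t,
      forall v, exists2 s, word m d s & x s = v,
      forall j s, word m d (j :: s) -> e (x s) (x (j :: s))
    & forall s w, word m d s -> e (x s) w ->
        (exists2 j, word m d (j :: s) & w = x (j :: s)) \/
        (exists j t, s = j :: t /\ w = x t)].
Proof.
pose good (vp : V * seq V) :=
  [/\ path e vp.1 vp.2, uniq (vp.1 :: vp.2) & last vp.1 vp.2 = r].
(* [ch] enumerates the children of [v]. Among the vertices of the path [p] to the root, only its
   first one is adjacent to [v], so away from the root exactly one neighbour is dropped. *)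
have /choice[ch chP] : forall vp, exists f, good vp ->
    enumerates f (branching m d (size vp.2)) [set w | e vp.1 w /\ w \notin vp.2].
  move=> [v p]; have [[/= vp up lp]|] := pselect (good (v, p)); last by exists (fun=> v).
  case: p vp up lp => [_ _ /= ->|q p vp up lp].
    have [f [fI fS]] := has_degree_enum deg_r.
    by exists f => _; split=> // w; split=> [[rw _]|/fS]; [exact/fS|].
  have vr : v <> r.
    by move=> E; move: up lp; rewrite E /= => /andP[+ _] lp; rewrite -{1}lp mem_last.
  have vq : e v q by case/andP: vp.
  have [f [fI fS]] := has_degree_enum_but (deg vr) vq.
  exists f => _; split=> // w; split=> [[/= vw wq]|/fS[/= vw wq]].
    by apply/fS; split=> // E; rewrite E mem_head in wq.
  by split=> //; apply/negP => /(tree_path_extend vp up vw)[/esym].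
(* The vertex reached by the word [s], with its path back to the root. *)
pose fix st s : V * seq V :=
  if s is j :: s' then (ch (st s') j, (st s').1 :: (st s').2) else (r, [::]).
have st_size s : size (st s).2 = size s by elim: s => //= j s ->.
have st_good s : word m d s -> good (st s).
  elim: s => [|j s IH] //= /andP[js /IH gs]; have [gp gu gl] := gs.
  have [_ cS] := chP _ gs.
  have [vw wn] : e (st s).1 (ch (st s) j) /\ ch (st s) j \notin (st s).2.
    by apply/cS; exists j; rewrite ?st_size.
  split=> //; first by rewrite /= e_sym vw.
  rewrite cons_uniq [X in _ && X]gu andbT inE negb_or wn andbT.
  by apply/eqP => /= E; move: vw; rewrite E e_irr.
have st_inj s t : word m d s -> word m d t -> st s = st t -> s = t.
  elim: s t => [|j s IH] [|k t] //=.
  move=> /andP[js ws] /andP[kt wt] [+ E1 E2].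
  have Est : st s = st t by rewrite [LHS]surjective_pairing [RHS]surjective_pairing E1 E2.
  have [cI _] := chP _ (st_good _ ws).
  have E := IH _ ws wt Est; rewrite -E in kt *.
  by move/cI => -> //; rewrite st_size.
exists (fun s => (st s).1).
have adj s w : word m d s -> e (st s).1 w ->
    (exists2 j, word m d (j :: s) & w = (st (j :: s)).1) \/
    (exists j t, s = j :: t /\ w = (st t).1).
  move=> ws sw; have gs := st_good _ ws; have [gp gu _] := gs.
  have [wp|wn] := boolP (w \in (st s).2).
    right; have := tree_path_extend gp gu sw wp.
    by case: (s) => // j t [<-]; exists j, t.
  left; have [_ cS] := chP _ gs; have /cS[j js <-] := conj sw wn.
  by exists j => //; rewrite /= ws -(st_size s) js.
split=> //.
(* Simple paths in a tree are unique, so the vertex alone already determines the stored path. *)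
- move=> s t ws wt E; apply: st_inj => //.
  have [p1 u1 l1] := st_good _ ws; have [p2 u2 l2] := st_good _ wt.
  rewrite [LHS]surjective_pairing [RHS]surjective_pairing -E; congr pair.
  by rewrite -E in p2 u2 l2; apply: tree_uniq_path p1 u1 p2 u2 _; rewrite l1.
- case: te => _ _ _ conn _ v; have [p rp <-] := conn r v.
  elim/last_ind: p rp => [_|p w IH]; first by exists [::].
  rewrite rcons_path last_rcons => /andP[/IH[s ws <-]].
  case/(adj _ _ ws) => [[j wj ->]|[j [t [Es ->]]]]; first by exists (j :: s).
  by exists t => //; move: ws; rewrite Es => /andP[].
- move=> j s /= /andP[js ws]; have [_ cS] := chP _ (st_good _ ws).
  have [] : [set w | e (st s).1 w /\ w \notin (st s).2] (ch (st s) j) => //.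
  by apply/cS; exists j; rewrite ?st_size.
Qed.

End Coordinates.

(** * Vertex stabilizers and the chain they generate *)

Section TreeActions.
Variables (G : groupType) (V : choiceType) (e : rel V) (a : G -> V -> V).
Hypothesis act : is_tree_action e a.
Implicit Types (g : G) (K : set G) (u v w : V).

Definition vertex_stabilizer v : set G := [set g | a g v = v].

Lemma tree_actK g v : a g^-1%g (a g v) = v.
Proof. by case: act => a1 aM _; rewrite -aM mulVg a1. Qed.

Lemma tree_act_inj g : injective (a g).
Proof. by move=> u v auv; rewrite -(tree_actK g u) auv tree_actK. Qed.

Lemma tree_act_adj g u v : e (a g u) (a g v) = e u v.
Proof. by case: act => _ _ ->. Qed.

Lemma vertex_stabilizer_subgroup v : is_subgroup (vertex_stabilizer v).
Proof.
case: act => a1 aM _; apply/is_subgroupP; split=> [|g h gv hv]; first exact: a1.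
by rewrite /vertex_stabilizer /= aM -{1}hv tree_actK gv.
Qed.

Lemma subgroupI K K' : is_subgroup K -> is_subgroup K' -> is_subgroup (K `&` K').
Proof.
move=> /is_subgroupP[K1 KV] /is_subgroupP[K1' KV']; apply/is_subgroupP; split=> //.
by move=> x y [Kx Kx'] [Ky Ky']; split; [exact: KV | exact: KV'].
Qed.

Lemma stabilizer_eqP g h v : a g v = a h v <-> a (g^-1 * h)%g v = v.
Proof.
case: act => _ aM _; rewrite aM; split=> [<-|E]; first exact: tree_actK.
by rewrite -{1}E -[X in a X]invgK tree_actK.
Qed.

Lemma index_le_stabilizer K v (A : set V) n : is_subgroup K ->
  (forall g, K g -> A (a g v)) -> A #<= `I_n ->
  index_le K (K `&` vertex_stabilizer v) n.
Proof.
move=> sK KA; apply: (index_le_fibers (f := a^~ v)) => //.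
move=> g h Kg Kh; rewrite stabilizer_eqP; split=> [|[]] // E; split=> //.
by apply: subgroupM => //; exact: subgroupV.
Qed.

Lemma has_degree_act g v n : has_degree e v n -> has_degree e (a g v) n.
Proof.
move=> dv; rewrite /has_degree; apply: card_eq_trans dv.
have -> : [set w | e (a g v) w] = a g @` [set w | e v w].
  apply/seteqP; split=> [w vw|_ [w vw <-]] /=; last by rewrite tree_act_adj.
  have gw : a g (a g^-1%g w) = w by rewrite -[X in a X _]invgK tree_actK.
  by exists (a g^-1%g w) => //=; rewrite -(tree_act_adj g) gw.
by apply: inj_card_eq => u w _ _; exact: tree_act_inj.
Qed.

Variable d : nat.

(** [K] fixes [v] and moves at most [d] of its neighbours. *)
Definition narrow K v : Prop :=
  (forall g, K g -> a g v = v) /\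
  (has_degree e v d \/
   has_degree e v d.+1 /\ exists2 q, e v q & forall g, K g -> a g q = q).

Lemma narrow_sub K K' v : K' `<=` K -> narrow K v -> narrow K' v.
Proof.
move=> KK' [Kv dv]; split=> [g /KK' /Kv //|]; case: dv => [|[dv [q vq Kq]]].
  by left.
by right; split=> //; exists q => // g /KK' /Kq.
Qed.

Hypothesis d_gt0 : (0 < d)%N.

(** The orbit of [w] stays among the neighbours of [v]. If these number [d.+1], the fixed neighbour
    [q] is either [w] itself, and the orbit is a point, or outside the orbit, which leaves [d]
    candidates. *)
Lemma narrow_index K v w : is_subgroup K -> narrow K v -> e v w ->
  index_le K (K `&` vertex_stabilizer w) d.
Proof.
move=> sK [Kv dv] vw.
have Kvw g : K g -> e v (a g w) by move=> Kg; rewrite -{1}(Kv g Kg) tree_act_adj.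
case: dv => [dv|[dv [q vq Kq]]].
  apply: (index_le_stabilizer (A := [set w | e v w])) => //.
  by rewrite /has_degree in dv; move/card_eqPle: dv => [].
have [<-|qw] := eqVneq q w.
  apply: (index_le_sub (m := 1)) => //.
  apply: (index_le_stabilizer (A := [set q])) => //.
  by move: (@card_set1 _ q) => /card_eqPle[].
have [f /enumerates_card] := has_degree_enum_but dv vq.
apply: index_le_stabilizer => // g Kg; split; first exact: Kvw.
by rewrite -(Kq g Kg) => /tree_act_inj wq; rewrite wq eqxx in qw.
Qed.

Variable r : V.
Hypothesis e_sym : symmetric e.
Hypothesis e_conn : forall v, exists2 p, path e r p & last r p = v.
Hypothesis degs : forall v, has_degree e v d \/ has_degree e v d.+1.

Lemma narrow_step K v w : narrow K v -> e v w ->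
  narrow (K `&` vertex_stabilizer w) w.
Proof.
move=> [Kv _] vw; split=> [g [] //|].
case: (degs w) => [|dw]; [by left|right; split=> //].
(* The previous vertex [v] is the fixed neighbour of [w]. *)
by exists v => [|g [/Kv]]; first by rewrite e_sym.
Qed.

(** Finite degrees and connectedness: a vertex is coded by the finite list of neighbour indices
    along a walk from [r]. This lets a chain indexed by [nat] reach every vertex. *)
Lemma vertices_enumerable : exists f : nat -> V, forall v, exists i, f i = v.
Proof.
have /choice[nb nbP] : forall v, exists f : nat -> V,
    forall w, e v w -> exists j, f j = w.
  move=> v; have [n] : exists n, has_degree e v n.
    by case: (degs v) => ?; [exists d | exists d.+1].
  by move/has_degree_enum => [f [_ fS]]; exists f => w /fS[j _ <-]; exists j.
pose walk := foldr (fun j v => nb v j) r.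
exists (fun i => walk (odflt [::] (unpickle i))) => v.
suff [s <-] : exists s, walk s = v by exists (pickle s); rewrite pickleK.
have [p rp <-] := e_conn v; elim/last_ind: p rp => [|p w IH]; first by exists [::].
rewrite rcons_path last_rcons => /andP[/IH[s <-] /nbP[j <-]].
by exists (j :: s).
Qed.

(** Intersect successively with stabilizers of vertices, keeping only the steps
    of index at most [d]; as every vertex is tried infinitely often, all of them
    end up fixed, by induction along a path from the root. *)
Lemma stabilizer_chain H : is_subgroup H -> narrow H r ->
  exists D : nat -> set G,
    [/\ D 0%N = H, forall i, is_subgroup (D i),
        forall i, D i.+1 `<=` D i, forall i, index_le (D i) (D i.+1) d
      & forall g, (forall i, D i g) -> forall v, a g v = v].
Proof.
move=> sH nH; have [f fS] := vertices_enumerable.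
pose step K v := if `[< index_le K (K `&` vertex_stabilizer v) d >]
                 then K `&` vertex_stabilizer v else K.
(* [logn 2 j] takes every natural value for infinitely many [j], so every vertex is tried again and
   again. *)
pose D := fix D i := if i is j.+1 then step (D j) (f (logn 2 j)) else H.
have sD i : is_subgroup (D i).
  elim: i => //= i IH; rewrite /step; case: asboolP => // _.
  by apply: subgroupI => //; exact: vertex_stabilizer_subgroup.
have Dsub i : D i.+1 `<=` D i.
  by rewrite /= /step; case: asboolP => _ g => [[]|].
have Dle i j : (i <= j)%N -> D j `<=` D i.
  elim: j => [|j IH]; first by rewrite leqn0 => /eqP ->.
  by rewrite leq_eqVlt => /predU1P[->//|/IH ij]; exact: subset_trans (Dsub j) ij.
exists D; split=> // [i|g Dg v].
  rewrite /= /step; case: asboolP => // _.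
  apply: (index_le_sub (m := 1)) => //.
  apply: (index_le_fibers (f := fun=> tt) (A := [set tt])) => //.
    by move=> x y Dx Dy; split=> // _; apply: subgroupM => //; exact: subgroupV.
  by move: (@card_set1 _ tt) => /card_eqPle[].
suff [N [Nv _]] : exists N, narrow (D N) v by exact/Nv/Dg.
have [p rp <-] := e_conn v; elim/last_ind: p rp => [_|p w IH]; first by exists 0%N.
rewrite rcons_path last_rcons => /andP[/IH[N nN] vw].
have [n fn] := fS w.
(* A stage no earlier than [N] at which the vertex tried is [f n = w]; the odd factor leaves the
   2-adic valuation at [n]. *)
pose i := (2 ^ n * (2 * N).+1)%N.
have logi : logn 2 i = n.
  rewrite /i lognM ?expn_gt0 // pfactorK // [X in (_ + X)%N](_ : _ = 0%N) ?addn0 //.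
  by apply/eqP; rewrite lognE /= dvdn2 /= mul2n odd_double.
have Ni : (N <= i)%N.
  apply: leq_trans (leq_pmull _ (expn_gt0 2 n)).
  by rewrite mul2n -addnn -addnS leq_addr.
have ni := narrow_sub (Dle _ _ Ni) nN.
exists i.+1; rewrite /= logi fn /step asboolT; first exact: narrow_step ni vw.
exact: narrow_index ni vw.
Qed.

End TreeActions.

(** * Fixed points in the geometric realization *)

Section FixedPoints.
Variables (R : realType) (G : groupType) (V : choiceType) (e : rel V).
Variable a : G -> V -> V.
Hypothesis act : is_tree_action e a.

(** Barycentric coordinates of a fixed point are constant on orbits, so the group permutes its
    support, which consists of one vertex or of the two ends of an edge. *)
Lemma fixed_vertex_or_edge : has_global_fixed_point R e a ->
  (exists v, forall g, a g v = v) \/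
  (exists u v, e u v /\
    forall g, (a g u, a g v) = (u, v) \/ (a g u, a g v) = (v, u)).
Proof.
move=> [p [_ [s [es p0 p1]]] pfix].
have pg g w : p (a g w) = p w.
  by rewrite -[in RHS](pfix g^-1%g) /act_point invgK.
have supp g w : p w <> 0%R -> a g w \in s.
  by move=> pw; apply: contra_notT pw => /p0; rewrite pg.
have single v : p v <> 0%R -> (forall w, w \in s -> p w <> 0%R -> w = v) ->
    exists v, forall g, a g v = v.
  move=> pv sv; exists v => g; apply: sv; first exact: supp.
  by rewrite pg.
have one0 : (1 : R)%R <> 0%R by apply/eqP; rewrite GRing.oner_eq0.
case: es => [[v Es]|[u [v [uv Es]]]]; subst s.
  left; apply: (single v) => [|w]; last by rewrite inE => /eqP.
  by move: p1; rewrite big_seq1 => ->.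
move: p1; rewrite big_cons big_seq1 => p1.
have [pu|pu] := pselect (p u = 0%R).
  left; apply: (single v) => [pv|w]; first by move: p1; rewrite pu pv GRing.addr0 => /esym.
  by rewrite !inE => /orP[] /eqP ->.
have [pv|pv] := pselect (p v = 0%R).
  left; apply: (single u) => // w.
  by rewrite !inE => /orP[] /eqP ->.
right; exists u, v; split=> // g.
have := supp g u pu; have := supp g v pv.
have inj := @tree_act_inj _ _ _ _ act g u v.
rewrite !inE => /orP[] /eqP gv /orP[] /eqP gu; rewrite gu gv; try by [left | right].
- by left; rewrite -(inj (etrans gu (esym gv))).
- by left; rewrite (inj (etrans gu (esym gv))).
Qed.

End FixedPoints.

(** The second component is the residual element acting on the letters that follow [w]. Since words
    list the last choice first, the recursion processes earlier choices before [j]. *)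
Fixpoint word_act (G : Type) (s : nat -> G -> nat -> nat) (k : nat -> G -> nat -> G)
    (g : G) (w : seq nat) : seq nat * G :=
  if w is j :: w' then
    let: (v, h) := word_act s k g w' in
    (s (size w') h j :: v, k (size w') h j)
  else ([::], g).

(** * The group action on words *)

Section WordAction.
Local Open Scope group_scope.
Variables (G : groupType) (C : nat -> set G) (m d : nat).
Variables (s : nat -> G -> nat -> nat) (k : nat -> G -> nat -> G) (z : nat -> nat).
Hypothesis C0 : C 0%N = setT.
Hypothesis sk_stable : forall i h j, C i h ->
  C i.+1 (k i h j) /\ ((j < branching m d i)%N -> (s i h j < branching m d i)%N).
Hypothesis sk1 : forall i j, s i 1 j = j /\ k i 1 j = 1.
Hypothesis skM : forall i g h j, C i g -> C i h ->
  s i (g * h) j = s i g (s i h j) /\ k i (g * h) j = k i g (s i h j) * k i h j.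
Hypothesis z_fix : forall i, (z i < branching m d i)%N /\
  forall h, C i h -> s i h (z i) = z i -> C i.+1 h /\ k i h (z i) = h.

Notation act := (word_act s k).

Lemma word_act_cons g j w : act g (j :: w) =
  (s (size w) (act g w).2 j :: (act g w).1, k (size w) (act g w).2 j).
Proof. by rewrite /=; case: (act g w). Qed.

Lemma size_word_act g w : size (act g w).1 = size w.
Proof. by elim: w => // j w IH; rewrite word_act_cons /= IH. Qed.

Lemma word_act_in g w : C (size w) (act g w).2.
Proof.
elim: w => [|j w IH]; first by rewrite C0.
by rewrite word_act_cons; exact: (sk_stable _ IH).1.
Qed.

Lemma word_act_word g w : word m d w -> word m d (act g w).1.
Proof.
elim: w => // j w IH; rewrite word_act_cons /= size_word_act => /andP[jb /IH ->].
by rewrite andbT; apply: (sk_stable _ (word_act_in g w)).2.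
Qed.

Lemma word_act1 w : act 1 w = (w, 1).
Proof.
elim: w => // j w IH; rewrite word_act_cons IH /=.
by have [-> ->] := sk1 (size w) j.
Qed.

Lemma word_actM g h w : act (g * h) w =
  ((act g (act h w).1).1, (act g (act h w).1).2 * (act h w).2).
Proof.
elim: w => // j w IH; rewrite !word_act_cons IH /= size_word_act.
have Cg : C (size w) (act g (act h w).1).2.
  by rewrite -(size_word_act h); exact: word_act_in.
by have [-> ->] := skM j Cg (word_act_in h w).
Qed.

Definition base_word (n : nat) : seq nat := iteri n (fun i w => z i :: w) [::].

Lemma size_base_word n : size (base_word n) = n.
Proof. by elim: n => //= n ->. Qed.

Lemma base_word_word n : word m d (base_word n).
Proof. by elim: n => //= n ->; rewrite size_base_word (z_fix n).1. Qed.

(** Along the base word the residual element remains [g], by [z_fix]; fixing one more letter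
    therefore puts [g] itself in the next subgroup. *)
Lemma word_act_base g : (forall n, (act g (base_word n)).1 = base_word n) ->
  forall n, C n g.
Proof.
move=> fixg n; suff [] : C n g /\ (act g (base_word n)).2 = g by [].
elim: n => [|n [Cn En]]; first by rewrite C0.
have := fixg n.+1; rewrite [base_word _.+1]/= -/(base_word n) word_act_cons.
by rewrite En size_base_word => -[/(z_fix n).2 -/(_ Cn) [? ->]].
Qed.

End WordAction.

(** * Transport of the word action to a tree *)

Section ChainAction.
Variables (R : realType) (G : groupType) (V : choiceType) (e : rel V) (r : V).
Variables (m d : nat).
Hypothesis te : is_tree e.
Hypothesis deg_r : has_degree e r m.
Hypothesis deg : forall v, v <> r -> has_degree e v d.+1.

Lemma chain_tree_action (C : nat -> set G) : descending_chain C ->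
  (forall i, index_le (C i) (C i.+1) (branching m d i)) ->
  acts_faithfully_with_fixed_point R G e.
Proof.
move=> [C0 sC Csub Cbig] Cidx.
have [x [x0 x_inj x_surj x_adj x_nb]] := tree_coordinates te deg_r deg.
have /choice[t tP] : forall v, exists w, word m d w /\ x w = v.
  move=> v; by have [w] := x_surj v; exists w.
have xK w : word m d w -> t (x w) = w.
  by move=> ww; have [tw xt] := tP (x w); apply: x_inj.
have /choice[skz skzP] : forall i, exists q : (G -> nat -> nat) * (G -> nat -> G) * nat,
    [/\ forall h j, C i h -> C i.+1 (q.1.2 h j) /\
          ((j < branching m d i)%N -> (q.1.1 h j < branching m d i)%N),
        forall j, q.1.1 1%g j = j /\ q.1.2 1%g j = 1%g,
        forall g h j, C i g -> C i h -> q.1.1 (g * h)%g j = q.1.1 g (q.1.1 h j) /\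
          q.1.2 (g * h)%g j = (q.1.2 g (q.1.1 h j) * q.1.2 h j)%g
      & (q.2 < branching m d i)%N /\
        forall h, C i h -> q.1.1 h q.2 = q.2 -> C i.+1 h /\ q.1.2 h q.2 = h].
  move=> i; have [s [k [z skz]]] :=
    coset_cocycle (sC i).1 (sC i.+1).1 (Csub i) (Cidx i).
  by exists (s, k, z).
pose s i := (skz i).1.1; pose k i := (skz i).1.2; pose z i := (skz i).2.
have stab i h j : C i h ->
    C i.+1 (k i h j) /\ ((j < branching m d i)%N -> (s i h j < branching m d i)%N).
  by case: (skzP i) => + _ _ _; apply.
have sk1 i j : s i 1%g j = j /\ k i 1%g j = 1%g.
  by case: (skzP i) => _ + _ _; apply.
have skM i g h j : C i g -> C i h -> s i (g * h)%g j = s i g (s i h j) /\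
    k i (g * h)%g j = (k i g (s i h j) * k i h j)%g.
  by case: (skzP i) => _ _ + _; apply.
have zfix i : (z i < branching m d i)%N /\
    forall h, C i h -> s i h (z i) = z i -> C i.+1 h /\ k i h (z i) = h.
  by case: (skzP i).
pose a g v := x (word_act s k g (t v)).1.
have actw g w : word m d w -> word m d (word_act s k g w).1.
  exact: (word_act_word C0 stab).
have ax g w : word m d w -> a g (x w) = x (word_act s k g w).1.
  by move=> ww; rewrite /a xK.
have a1 v : a 1%g v = v by rewrite /a word_act1 //; have [] := tP v.
have aM g h v : a (g * h)%g v = a g (a h v).
  have [tw <-] := tP v.
  by rewrite !ax ?actw // (word_actM C0 stab skM).
(* Each edge joins a word to its extension by one letter, and acting commutes with deleting that
   letter. *)
have a_homo g u v : e u v -> e (a g u) (a g v).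
  have [e_sym _ _ _ _] := te.
  have a_edge j w : word m d (j :: w) -> e (a g (x w)) (a g (x (j :: w))).
    move=> jw; have ww : word m d w by case/andP: jw.
    by rewrite !ax // word_act_cons /=; apply: x_adj; move: (actw g _ jw); rewrite word_act_cons.
  have [[wu <-] [wv <-]] := (tP u, tP v) => /(x_nb _ _ wu)[[j jw ->]|[j [w [E ->]]]].
    exact: a_edge.
  by rewrite E in wu *; rewrite e_sym; exact: a_edge.
exists a; split.
- split=> // g u v; apply/idP/idP; last exact: a_homo.
  by move/(a_homo g^-1%g); rewrite -!aM mulVg !a1.
- move=> g gfix; suff : [set 1%g] g by [].
  rewrite -Cbig => i _; apply: (word_act_base C0 zfix) => n.
  apply: x_inj; [|exact: (base_word_word zfix)|].
    by apply: actw; exact: (base_word_word zfix).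
  by rewrite -ax ?gfix //; exact: (base_word_word zfix).
(* The root is the empty word, hence fixed; the unit mass there is the fixed point. *)
- have ar g : a g r = r by rewrite -x0 ax.
  exists (fun v => if v == r then 1%R else 0%R) => [|g]; last first.
    apply/funext => v; rewrite /act_point; congr (if _ then _ else _).
    apply/eqP/eqP => [E|->//].
    by rewrite -(a1 v) -(mulgV g) aM E.
  split=> [v|]; first by case: eqP => _; rewrite ?Num.Theory.ler01.
  exists [:: r]; split; first by left; exists r.
    by move=> v; rewrite inE => /negPf ->.
  by rewrite big_seq1 eqxx.
Qed.

End ChainAction.

(** * From actions to chains, and the two equivalences *)

Lemma rooted_action_chain (R : realType) (d : nat) (G : groupType)
    (V : choiceType) (e : rel V) (r : V) :
  (0 < d)%N -> is_regular_rooted_tree d e r ->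
  acts_faithfully_with_fixed_point R G e -> has_index_chain d G.
Proof.
move=> d0 [[e_sym _ _ conn _] dr dv] [a [act faith _]].
have degs v : has_degree e v d \/ has_degree e v d.+1.
  by have [->|/eqP/dv] := eqVneq v r; [left | right].
(* Automorphisms preserve degrees, and the root is the only vertex of degree [d]. *)
have nr : narrow e a d [set: G] r.
  split=> [g _|]; last by left.
  apply/eqP/negPn/negP => /eqP/dv /has_degree_inj/(_ (has_degree_act act g dr)).
  by move/eqP; rewrite eqn_leq ltnn.
have sT : is_subgroup [set: G] by apply/is_subgroupP.
have [D [D0 sD Dsub Didx Dfix]] :=
  stabilizer_chain act d0 e_sym (conn r) degs sT nr.
exists D; split=> //; split=> // [i|].
  split=> //; elim: i => [|i fi]; first by rewrite D0; exact: finite_index_setT.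
  exact: finite_index_trans fi (sD i) (Didx i).
apply/seteqP; split=> [g Dg|_ -> i _]; last exact: subgroup1.
by apply/faith/Dfix => i; exact: Dg.
Qed.

Lemma regular_action_chain (R : realType) (d : nat) (G : groupType)
    (V : choiceType) (e : rel V) :
  (0 < d)%N -> is_regular_tree d.+1 e ->
  acts_faithfully_with_fixed_point R G e ->
  exists C : nat -> set G,
    [/\ descending_chain C, index_le (C 0%N) (C 1%N) d.+1
      & forall i, (1 <= i)%N -> index_le (C i) (C i.+1) d].
Proof.
move=> d0 [[e_sym _ _ conn _] deg] [a [act faith afix]].
have sT : is_subgroup [set: G] by apply/is_subgroupP.
(* An edge whose ordered pair of ends has at most [d.+1] images: if [u] is fixed, [v] moves among
   [d.+1] neighbours; if the edge is only preserved, there are two images, and [d] is positive. *)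
have [u [v [uv [A Asub An]]]] : exists u v, e u v /\
    exists2 A, (forall g, A (a g u, a g v)) & A #<= `I_d.+1.
  case: (fixed_vertex_or_edge act afix) => [[u fu]|[u [v [uv fuv]]]].
    have [f [fI fS]] := has_degree_enum (deg u).
    have uf j : (j < d.+1)%N -> e u (f j) by move=> jd; apply/fS; exists j.
    exists u, (f 0%N); split; first exact: uf.
    exists [set (u, w) | w in [set w | e u w]] => [g|].
      exists (a g (f 0%N)); last by rewrite fu.
      by rewrite /= -{1}(fu g) (tree_act_adj act); exact: uf.
    by apply: (card_le_trans (card_image_le _ _)); exact: (enumerates_card (conj fI fS)).
  exists u, v; split=> //.
  exists ((fun i => if i is 0%N then (u, v) else (v, u)) @` `I_2) => [g|].
    by case: (fuv g) => ->; [exists 0%N | exists 1%N].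
  by apply: (card_le_trans (card_image_le _ _)); rewrite card_le_II.
pose H := vertex_stabilizer a u `&` vertex_stabilizer a v.
have sH : is_subgroup H by apply: subgroupI; exact: vertex_stabilizer_subgroup act _.
have HT : index_le [set: G] H d.+1.
  apply: (index_le_fibers (f := fun g => (a g u, a g v))) An => // g h _ _.
  split=> [[]|[]] /(stabilizer_eqP act) Eu /(stabilizer_eqP act) Ev; first by split.
  by rewrite Eu Ev.
have nH : narrow e a d H u.
  split=> [g [] //|]; right; split=> //.
  by exists v => // g [].
have [D [D0 sD Dsub Didx Dfix]] :=
  stabilizer_chain act d0 e_sym (conn u) (fun w => or_intror (deg w)) sH nH.
(* Putting the whole group before [D] confines the bound [d.+1] to the first index, that of [H]. *)
exists (fun i => if i is j.+1 then D j else [set: G]); split=> [||[|i] //]; last first.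
- by rewrite D0.
have fT : finite_index [set: G] by exact: finite_index_setT.
split=> // [[|i] //|[|i] //|].
  split=> //; elim: i => [|i fi]; first by rewrite D0; exact: finite_index_trans fT sT HT.
  exact: finite_index_trans fi (sD i) (Didx i).
apply/seteqP; split=> [g Dg|_ -> [|i] _ //]; last exact: subgroup1.
by apply/faith/Dfix => i; exact: (Dg i.+1).
Qed.

Theorem theorem3p2 (R : realType) (d : nat) (hd : (2 <= d)%N) (G : groupType) :
  (forall (V : choiceType) (e : rel V) (r : V),
      is_regular_rooted_tree d e r ->
      (acts_faithfully_with_fixed_point R G e <-> has_index_chain d G))
  /\
  (forall (V : choiceType) (e : rel V),
      is_regular_tree d.+1 e ->
      (acts_faithfully_with_fixed_point R G e <->
       exists C : nat -> set G,
         [/\ descending_chain C,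
             index_le (C 0%N) (C 1%N) d.+1
           & forall i, (1 <= i)%N -> index_le (C i) (C i.+1) d])).
Proof.
have d0 : (0 < d)%N by exact: ltnW.
split=> [V e r tr|V e tr]; split.
- exact: rooted_action_chain d0 tr.
- move=> [C [dC Cidx]]; have [te dr dv] := tr.
  by apply: (chain_tree_action R te dr dv dC) => -[|i]; exact: Cidx.
- exact: regular_action_chain d0 tr.
(* Any vertex can serve as root, now with [d.+1] children. *)
- move=> [C [dC C01 Cidx]]; have [te deg] := tr; have [_ _ [r] _ _] := te.
  by apply: (chain_tree_action R te (deg r) (fun v _ => deg v) dC) => -[|i] //; exact: Cidx.
Qed.
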